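(* Let $\widehat\Sigma\in\mathbb{R}^{n\times n}$ be symmetric strictly positive definite, partitioned as $\widehat\Sigma=\begin{pmatrix}\widehat\Sigma_{11}&\widehat\Sigma_{12}\\ \widehat\Sigma_{21}&\widehat\Sigma_{22}\end{pmatrix}$ with $\widehat\Sigma_{ii}$ of size $n_i\times n_i$, $n_1+n_2=n$. Let $H=\begin{pmatrix}H_1\\H_2\end{pmatrix}$ with $H_1\in\mathbb{R}^{n_1\times k}$, $H_2\in\mathbb{R}^{n_2\times k}$, $H_2H_2^\top>0$, and $D=\begin{pmatrix}D_1&0\\0&0\end{pmatrix}$ with $D_1\in\mathbb{R}^{n_1\times n_1}$ diagonal, $D_1>0$. If $(H,D)$ is a stationary point of the alternating minimization algorithm, then $$\widehat\Sigma_{22}=H_2H_2^\top\qquad\text{and}\qquad \widehat\Sigma_{12}=H_1H_2^\top.$$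
   Context: $k<n$. The alternating minimization algorithm maps a pair $(H,D)$, with $H\in\mathbb{R}^{n\times k}$, $D\ge0$ diagonal and $HH^\top+D$ invertible, to the pair $(H',D')$ given by $$H'=\widehat\Sigma(HH^\top+D)^{-1}HR^{-1/2},\qquad D'=\Delta(\widehat\Sigma-H'H'^\top),$$ $$R=I-H^\top(HH^\top+D)^{-1}H+H^\top(HH^\top+D)^{-1}\widehat\Sigma(HH^\top+D)^{-1}H,$$ where $R^{-1/2}$ is the inverse of the symmetric positive definite square root of the (strictly positive definite) matrix $R$, and $\Delta(M)$ is the diagonal matrix with the same diagonal as the square matrix $M$. A stationary point is a pair $(H,D)$ with $(H',D')=(H,D)$. *)

(* Defs.v *)
From mathcomp Require Import all_boot all_order all_algebra.
From mathcomp Require Import classical_sets reals.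

Set Implicit Arguments.
Unset Strict Implicit.
Unset Printing Implicit Defensive.

Import Order.TTheory GRing.Theory Num.Theory.
Local Open Scope ring_scope.

Definition posdefmx (R : realType) (n : nat) (A : 'M[R]_n) : Prop :=
  A^T = A /\ forall x : 'cV[R]_n, x != 0 -> 0 < (x^T *m A *m x) 0 0.

Definition possemidefmx (R : realType) (n : nat) (A : 'M[R]_n) : Prop :=
  A^T = A /\ forall x : 'cV[R]_n, 0 <= (x^T *m A *m x) 0 0.

(* For positive definite A this is its unique positive definite square root.
   If A has no such square root the value is the dummy 0. *)
Definition sqrtmx (R : realType) (n : nat) (A : 'M[R]_n) : 'M[R]_n :=
  xget 0 [set S : 'M[R]_n | posdefmx S /\ S *m S = A]%classic.

Definition diagpart (R : realType) (n : nat) (A : 'M[R]_n) : 'M[R]_n :=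
  diag_mx (\row_i A i i).

Section AlternatingMinimization.
Variables (R : realType) (n k : nat) (Sigma : 'M[R]_n).

Definition altmin_R (H : 'M[R]_(n, k)) (D : 'M[R]_n) : 'M[R]_k :=
  let C := H *m H^T + D in
  1%:M - H^T *m invmx C *m H + H^T *m invmx C *m Sigma *m invmx C *m H.

Definition altmin_H (H : 'M[R]_(n, k)) (D : 'M[R]_n) : 'M[R]_(n, k) :=
  Sigma *m invmx (H *m H^T + D) *m H *m invmx (sqrtmx (altmin_R H D)).

Definition altmin_D (H : 'M[R]_(n, k)) (D : 'M[R]_n) : 'M[R]_n :=
  diagpart (Sigma - altmin_H H D *m (altmin_H H D)^T).

Definition altmin_step (HD : 'M[R]_(n, k) * 'M[R]_n) :
    'M[R]_(n, k) * 'M[R]_n :=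
  (altmin_H HD.1 HD.2, altmin_D HD.1 HD.2).

(* invmx is total, so the domain of the algorithm has to be stated. *)
Definition altmin_dom (HD : 'M[R]_(n, k) * 'M[R]_n) : Prop :=
  [/\ is_diag_mx HD.2, possemidefmx HD.2
    & HD.1 *m HD.1^T + HD.2 \in unitmx].

Definition stationary (HD : 'M[R]_(n, k) * 'M[R]_n) : Prop :=
  altmin_dom HD /\ altmin_step HD = HD.

End AlternatingMinimization.

(* Main.v *)
Require Import Defs.
From mathcomp Require Import all_boot all_order all_algebra.
From mathcomp Require Import classical_sets reals.

(** Write [C = H H^T + D] and [G = H^T C^-1 H].  The argument has two halves.

    At a stationary point with an invertible square root [S] of the matrix [R]
    of the algorithm, the first equation reads [H S = Sigma C^-1 H].  Multiplied
    on the left by [H^T C^-1], it turns the last term of [R] into [G S], so that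
    [S^2 = I - G + G S], that is [(S + (I - G)) (S - I) = 0].  Now
    [I - G = (I - G)^T (I - G) + (C^-1 H)^T D (C^-1 H)] is positive
    semidefinite, hence [S + (I - G)] is positive definite and [S = I]
    ([stationary_fixpoint]): a stationary point satisfies [Sigma C^-1 H = H].

    The zero block of [D] makes the last [n2] columns of [C] equal to
    [H H2^T], that is [C^-1 H H2^T = (0; I)].  Therefore
    [Sigma (0; I) = Sigma C^-1 H H2^T = H H2^T], which is the pair of equations
    to be proved.

    The square root is given by a choice with default value [0].  The default
    would make the update of [H] vanish, so that [H2 = 0]; as [H2 H2^T] is
    positive definite, this is possible only when [n2 = 0], where both equations
    hold between empty matrices. *)

Set Implicit Arguments.
Unset Strict Implicit.
Unset Printing Implicit Defensive.

Import Order.TTheory GRing.Theory Num.Theory.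
Local Open Scope ring_scope.

Lemma posdefmx_mul_eq0 (R : realType) (n p : nat) (A : 'M[R]_n)
    (X : 'M[R]_(n, p)) : posdefmx A -> A *m X = 0 -> X = 0.
Proof.
move=> [_ Apos] AX0; apply/matrixP => i j.
have [colX0|/Apos] := eqVneq (col j X) 0.
  by move/matrixP/(_ i 0): colX0; rewrite !mxE.
by rewrite -mulmxA [in X in A *m X]colE (mulmxA A) AX0 mul0mx mulmx0 mxE ltxx.
Qed.

Lemma posdefmx_unit (R : realType) (n : nat) (A : 'M[R]_n) :
  posdefmx A -> A \in unitmx.
Proof.
move=> Apd; have [AT _] := Apd.
rewrite -row_free_unit -kermx_eq0 -[kermx A]trmxK trmx_eq0; apply/eqP.
apply: (posdefmx_mul_eq0 Apd).
by rewrite -[in X in X *m _]AT -trmx_mul mulmx_ker trmx0.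
Qed.

Lemma posdefmxD (R : realType) (n : nat) (A B : 'M[R]_n) :
  posdefmx A -> possemidefmx B -> posdefmx (A + B).
Proof.
move=> [AT Apos] [BT Bpos]; split; first by rewrite linearD /= AT BT.
move=> x x0; rewrite mulmxDr mulmxDl mxE.
exact: ltr_pwDl (Apos x x0) (Bpos x).
Qed.

Lemma possemidefmxD (R : realType) (n : nat) (A B : 'M[R]_n) :
  possemidefmx A -> possemidefmx B -> possemidefmx (A + B).
Proof.
move=> [AT Apos] [BT Bpos]; split; first by rewrite linearD /= AT BT.
by move=> x; rewrite mulmxDr mulmxDl mxE addr_ge0.
Qed.

Lemma possemidefmx_congr (R : realType) (n p : nat) (A : 'M[R]_n)
    (X : 'M[R]_(n, p)) : possemidefmx A -> possemidefmx (X^T *m A *m X).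
Proof.
move=> [AT Apos]; split; first by rewrite !trmx_mul trmxK AT mulmxA.
by move=> x; have := Apos (X *m x); rewrite trmx_mul !mulmxA.
Qed.

Lemma possemidefmx1 (R : realType) (n : nat) :
  possemidefmx (1%:M : 'M[R]_n).
Proof.
split=> [|x]; first exact: trmx1.
rewrite mulmx1 mxE; apply: sumr_ge0 => i _.
by rewrite mxE -expr2 sqr_ge0.
Qed.

Lemma mulmx_invmx0 (R : realType) (m n : nat) (A : 'M[R]_(m, n)) :
  A *m invmx 0 = 0.
Proof.
have [u0|nu0] := boolP ((0 : 'M[R]_n) \in unitmx).
  (* [0] is a unit only when [n = 0], where it is also the identity. *)
  by rewrite -[LHS]mulmx1 -(mulVmx u0) !mulmx0.
by rewrite invmx_out ?mulmx0.
Qed.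

Lemma sqrtmxP (R : realType) (n : nat) (A : 'M[R]_n) :
  sqrtmx A = 0 \/ posdefmx (sqrtmx A) /\ sqrtmx A *m sqrtmx A = A.
Proof. by rewrite /sqrtmx; case: xgetP => [S _ [Spd SS]|_]; [right|left]. Qed.

(** With [M = C^-1 H] one has [H^T M = M^T C M = G], and
    [I - G] is the sum of the Gram matrix of [I - G] and of [M^T D M]. *)
Lemma possemidefmx_residual (R : realType) (n k : nat)
    (H : 'M[R]_(n, k)) (D : 'M[R]_n) :
  possemidefmx D -> H *m H^T + D \in unitmx ->
  possemidefmx (1%:M - H^T *m invmx (H *m H^T + D) *m H).
Proof.
move=> Dpsd; have [DT _] := Dpsd.
set C := H *m H^T + D => Cu.
have CT : C^T = C by rewrite linearD /= trmx_mul trmxK DT.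
pose M := invmx C *m H.
have MT : M^T = H^T *m invmx C by rewrite trmx_mul trmx_inv CT.
rewrite -mulmxA -/M.
have GT : (H^T *m M)^T = H^T *m M by rewrite trmx_mul trmxK MT mulmxA.
have MTDM : M^T *m D *m M = H^T *m M - H^T *m M *m (H^T *m M).
  have -> : D = C - H *m H^T by rewrite /C addrC addKr.
  have MTH : M^T *m H = H^T *m M by rewrite MT -mulmxA.
  rewrite mulmxBr mulmxBl; congr (_ - _); first by rewrite MT mulmxKV.
  by rewrite (mulmxA M^T H) MTH -[LHS]mulmxA.
suff -> : 1%:M - H^T *m M =
    (1%:M - H^T *m M)^T *m 1%:M *m (1%:M - H^T *m M) + M^T *m D *m M.
  by apply: possemidefmxD; apply: possemidefmx_congr => //;
    exact: possemidefmx1.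
by rewrite MTDM [(_ - _)^T]linearB /= trmx1 GT mulmx1 mulmxBr mulmx1 mulmxBl mul1mx subrK.
Qed.

(** The square root is the identity at a stationary point, so the fixed point
    equation for [H] loses its nonlinear factor. *)
Lemma stationary_fixpoint (R : realType) (n k : nat) (Sigma : 'M[R]_n)
    (H : 'M[R]_(n, k)) (D : 'M[R]_n) :
  possemidefmx D -> H *m H^T + D \in unitmx -> altmin_H Sigma H D = H ->
  H = 0 \/ Sigma *m invmx (H *m H^T + D) *m H = H.
Proof.
move=> Dpsd Cu; rewrite /altmin_H.
have [->|[]] := sqrtmxP (altmin_R Sigma H D).
  by rewrite mulmx_invmx0 => <-; left.
set S := sqrtmx _ => Spd SS HE; right.
have Su := posdefmx_unit Spd.
have HS : Sigma *m invmx (H *m H^T + D) *m H = H *m S.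
  by rewrite -[in RHS]HE mulmxKV.
have Gpsd := possemidefmx_residual Dpsd Cu.
move: SS; rewrite /altmin_R /=.
set Ci := invmx _ in HS Gpsd *; set G := H^T *m Ci *m H in Gpsd *.
have -> : H^T *m Ci *m Sigma *m Ci *m H = G *m S.
  by rewrite -!mulmxA (mulmxA Ci H S) -(mulmxA Ci H) -HS -!mulmxA.
move=> SS; rewrite HS.
suff /subr0_eq -> : S - 1%:M = 0 by rewrite mulmx1.
apply: (posdefmx_mul_eq0 (posdefmxD Spd Gpsd)).
rewrite mulmxDl mulmxBl !mulmxBr !mulmx1 mul1mx SS -[S - 1%:M - _]addrA subrKA.
by rewrite -opprD -[1%:M - G + _]addrA [- G + _]addrC subrr.
Qed.

Theorem proposition7p1 (R : realType) (n1 n2 k : nat) (hkn : (k < n1 + n2)%N)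
    (Sigma : 'M[R]_(n1 + n2)) (hSigma : posdefmx Sigma)
    (H1 : 'M[R]_(n1, k)) (H2 : 'M[R]_(n2, k)) (hH2 : posdefmx (H2 *m H2^T))
    (D1 : 'M[R]_n1) (hD1diag : is_diag_mx D1) (hD1 : posdefmx D1)
    (hstat : stationary Sigma (col_mx H1 H2, block_mx D1 0 0 0)) :
  drsubmx Sigma = H2 *m H2^T /\ ursubmx Sigma = H1 *m H2^T.
Proof.
case: hstat => -[_ /= Dpsd Cu] [HE _].
have [H0|fixH] := stationary_fixpoint Dpsd Cu HE.
  (* [H2 H2^T] is both zero and positive definite, which forces [n2 = 0] and
     makes every matrix with [n2] rows vanish. *)
  have H20 : H2 = 0 by rewrite -(col_mxKd H1 H2) H0 linear0.
  have triv p (X : 'M[R]_(n2, p)) : X = 0.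
    by apply: (posdefmx_mul_eq0 hH2); rewrite H20 !mul0mx.
  split; first by rewrite (triv _ (drsubmx Sigma)) (triv _ (H2 *m _)).
  by apply: trmx_inj; rewrite (triv _ _^T) [RHS](triv _ _^T).
move: Cu fixH; set C := _ + _ => Cu fixH.
pose E : 'M[R]_(n1 + n2, n2) := col_mx 0 1%:M.
have CE : C *m E = col_mx H1 H2 *m H2^T.
  rewrite /C /E mulmxDl -mulmxA tr_col_mx mul_row_col mulmx0 add0r mulmx1.
  by rewrite mul_block_col !mulmx0 !mul0mx !addr0 col_mx0 addr0.
have SigmaE : Sigma *m E = col_mx H1 H2 *m H2^T.
  by rewrite -[in RHS]fixH -[RHS]mulmxA -CE -mulmxA mulKmx.
move: SigmaE; rewrite /E mul_col_mx -[in LHS](submxK Sigma) mul_block_col.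
by rewrite !mulmx0 !mulmx1 !add0r => /eq_col_mx [].
Qed.
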